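(* Let $d\ge2$, $A\in\mathcal C^{d-1}$ and $C_1,C_2\in\mathcal C^d_A$. Then $$D_{A,1}(C_1,C_2)=\int_{\mathbb I}\big\|Q^\tau_{C_1}-Q^\tau_{C_2}\big\|_{A,1}\,\mathrm d\lambda(\tau)\le\tfrac12,$$ and the bound $\tfrac12$ is attained for some $C_1,C_2\in\mathcal C^d_A$.
   Context: $\mathbb I=[0,1]$, $\lambda$ Lebesgue measure. A $d$-copula $C\in\mathcal C^d$ is the distribution function on $\mathbb I^d$ of a probability measure $\mu_C$ with uniform univariate marginals; points are $(\mathbf x,y)$, $\mathbf x\in\mathbb I^{d-1}$. $C_{1:(d-1)}$ is the marginal copula of the first $d-1$ coordinates; $\mathcal C^d_A=\{C\in\mathcal C^d:C_{1:(d-1)}=A\}$ (for $d=2$, $\mu_A=\lambda$, $\mathcal C^2_A=\mathcal C^2$). $K_C$ is the Markov kernel of $C$ w.r.t. the first $d-1$ coordinates: $\mu_C(B\times F)=\int_B K_C(\mathbf x,F)\,\mathrm d\mu_{A}(\mathbf x)$ for $C\in\mathcal C^d_A$. $Q^\tau_C(\mathbf x)=\inf\{y\in\mathbb I: K_C(\mathbf x,[0,y])\ge\tau\}$. $\|f\|_{A,1}=\int|f|\,\mathrm d\mu_A$. $D_{A,1}(C_1,C_2)=\int_{\mathbb I}\int_{\mathbb I^{d-1}}|K_{C_1}(\mathbf x,[0,y])-K_{C_2}(\mathbf x,[0,y])|\,\mathrm d\mu_A(\mathbf x)\,\mathrm d\lambda(y)$. *)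

(* Defs.v *)
From HB Require Import structures.
From mathcomp Require Import all_boot all_order all_algebra.
From mathcomp Require Import all_classical all_reals all_analysis.
Set Implicit Arguments. Unset Strict Implicit. Unset Printing Implicit Defensive.
Import Order.TTheory GRing.Theory Num.Theory.
Local Open Scope classical_set_scope.
Local Open Scope ring_scope.
Local Open Scope ereal_scope.

Section copulas.
Context {R : realType}.

Definition uniform_marginal {dT} {T : measurableType dT}
    (mu : set T -> \bar R) (f : T -> R) : Prop :=
  forall B : set R, measurable B ->
    mu (f @^-1` B) = (@lebesgue_measure R) (B `&` `[0%R, 1%R]%classic).

(* mu = mu_A for a k-copula A, points of I^k being k-tuples of reals. *)
Definition is_copula_measure (k : nat) (mu : probability (k.-tuple R) R) : Prop :=
  forall i : 'I_k, uniform_marginal mu (fun x => tnth x i).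

(* mu = mu_C for a (k+1)-copula C, points written (x, y) with x in I^k, y in I. *)
Definition is_copula_measure_xy (k : nat)
    (mu : probability (k.-tuple R * R)%type R) : Prop :=
  (forall i : 'I_k, uniform_marginal mu (fun p => tnth p.1 i)) /\
  uniform_marginal mu snd.

Definition in_CdA (k : nat) (muA : probability (k.-tuple R) R)
    (mu : probability (k.-tuple R * R)%type R) : Prop :=
  is_copula_measure_xy mu /\
  forall B : set (k.-tuple R), measurable B -> mu (B `*` setT) = muA B.

Definition is_markov_kernel_of (k : nat) (muA : probability (k.-tuple R) R)
    (mu : probability (k.-tuple R * R)%type R)
    (K : R.-pker (k.-tuple R) ~> R) : Prop :=
  forall (B : set (k.-tuple R)) (F : set R), measurable B -> measurable F ->
    mu (B `*` F) = \int[muA]_(x in B) K x F.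

Definition quantile (k : nat) (K : R.-pker (k.-tuple R) ~> R)
    (tau : R) (x : k.-tuple R) : R :=
  inf [set y : R | (0 <= y <= 1)%R /\ tau%:E <= K x `[0%R, y]%classic].

Definition D_A1 (k : nat) (muA : probability (k.-tuple R) R)
    (K1 K2 : R.-pker (k.-tuple R) ~> R) : \bar R :=
  \int[@lebesgue_measure R]_(y in `[0%R, 1%R])
     \int[muA]_x `| K1 x `[0%R, y]%classic - K2 x `[0%R, y]%classic |.

Definition quantile_dist (k : nat) (muA : probability (k.-tuple R) R)
    (K1 K2 : R.-pker (k.-tuple R) ~> R) : \bar R :=
  \int[@lebesgue_measure R]_(tau in `[0%R, 1%R])
     \int[muA]_x (`| quantile K1 tau x - quantile K2 tau x |)%:E.

End copulas.

(* Main.v *)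
(* For a fixed x, tau <= F(y) iff Q(tau) <= y, where F is the conditional
   distribution function and Q its quantile function.  Hence |F1 - F2| and
   |Q1 - Q2| both integrate to the area between the graphs of F1 and F2; Tonelli
   then integrates this over x.  Since F_i(x, y) has mean y over x, the mean of
   |F1 - F2| is at most both 2y (triangle inequality) and 2(1 - y) (the same for
   1 - F_i), and min(2y, 2(1 - y)) has integral 1/2.  With U the first
   coordinate, the completely dependent copulas Y = U and Y = 1 - U give
   equality for every y. *)
Require Import Defs.
From HB Require Import structures.
From mathcomp Require Import all_boot all_order all_algebra.
From mathcomp Require Import all_classical all_reals all_analysis.
From mathcomp Require Import measurable_realfun lra.
Set Implicit Arguments.
Unset Strict Implicit.
Unset Printing Implicit Defensive.
Import Order.TTheory GRing.Theory Num.Theory.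
Import numFieldNormedType.Exports.
Local Open Scope classical_set_scope.
Local Open Scope ring_scope.
Local Open Scope ereal_scope.

(** Tonelli on the whole product space, applied to [f] extended by zero outside the rectangle. *)
Lemma fubini_tonelli_in d1 d2 (T1 : measurableType d1) (T2 : measurableType d2)
    (R : realType) (m1 : {sigma_finite_measure set T1 -> \bar R})
    (m2 : {sigma_finite_measure set T2 -> \bar R}) (D1 : set T1) (D2 : set T2)
    (f : T1 * T2 -> \bar R) :
  measurable D1 -> measurable D2 -> measurable_fun [set: T1 * T2] f ->
  (forall p, 0 <= f p) ->
  \int[m1]_(x in D1) \int[m2]_(y in D2) f (x, y) =
  \int[m2]_(y in D2) \int[m1]_(x in D1) f (x, y).
Proof.
move=> mD1 mD2 mf f0; pose g := f \_ (D1 `*` D2).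
have mg : measurable_fun [set: T1 * T2] g.
  apply/(measurable_restrictT _ _).1; first exact: measurableX.
  exact: measurable_funTS.
have g0 p : 0 <= g p by rewrite /g patchE; case: ifP.
have gE x y : g (x, y) = if x \in D1 then (if y \in D2 then f (x, y) else 0)
    else 0.
  by rewrite /g patchE in_setX; case: (x \in D1); case: (y \in D2).
have := @fubini_tonelli _ _ _ _ _ m1 m2 g mg g0.
congr (_ = _); rewrite [RHS]integral_mkcond; apply: eq_integral => x _.
- rewrite patchE; case: ifPn => xD1; last first.
    by apply: integral0_eq => y _; rewrite gE (negbTE xD1).
  rewrite [RHS]integral_mkcond; apply: eq_integral => y _.
  by rewrite gE xD1 patchE.
- rewrite patchE; case: ifPn => xD2; last first.
    by apply: integral0_eq => y _; rewrite gE (negbTE xD2) if_same.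
  rewrite [RHS]integral_mkcond; apply: eq_integral => y _.
  by rewrite gE xD2 patchE.
Qed.

(** * Area between two graphs, for a fixed conditioning point *)

Section one_dimensional.
Context {R : realType}.
Implicit Types a b : R.
Local Notation lebesgue := (@lebesgue_measure R).

(** For a <= b the integrand is the indicator of [[a, b[], an interval inside the unit interval. The
    companion with the inequalities reversed uses []a, b]]. *)
Lemma integral_abs_step a b : (0 <= a <= 1)%R -> (0 <= b <= 1)%R ->
  \int[lebesgue]_(y in `[0%R, 1%R])
    (`|(a <= y)%R%:R - (b <= y)%R%:R|)%:E = (`|a - b|)%:E.
Proof.
wlog ab : a b / (a <= b)%R => [hw|].
  have [/hw//|/ltW ba] := leP a b; move=> a01 b01.
  rewrite distrC -(hw b a)//.
  by apply: eq_integral => y _; rewrite distrC.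
move=> /andP[a0 a1] /andP[b0 b1].
transitivity (\int[lebesgue]_(y in `[0%R, 1%R]) (\1_(`[a, b[ : set R) y)%:E).
  apply: eq_integral => y _; rewrite indicE mem_setE in_itv/=.
  have [ay|ya] := leP a y; have [b_y|yb] := leP b y;
    rewrite /= ?subrr ?subr0 ?sub0r ?normr0 ?normr1//.
  by have := lt_le_trans ya (le_trans ab b_y); rewrite ltxx.
rewrite integral_indic// (setIidl _); last first.
  move=> y /=; rewrite !in_itv/= => /andP[ay yb].
  by rewrite (le_trans a0 ay) (le_trans (ltW yb) b1).
rewrite /= lebesgue_measure_itv/= lte_fin distrC ger0_norm ?subr_ge0//.
by move: ab; rewrite le_eqVlt => /predU1P[->|->]; rewrite ?ltxx ?subrr ?EFinB.
Qed.

Lemma integral_abs_stepr a b : (0 <= a <= 1)%R -> (0 <= b <= 1)%R ->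
  \int[lebesgue]_(y in `[0%R, 1%R])
    (`|(y <= a)%R%:R - (y <= b)%R%:R|)%:E = (`|a - b|)%:E.
Proof.
wlog ab : a b / (a <= b)%R => [hw|].
  have [/hw//|/ltW ba] := leP a b; move=> a01 b01.
  rewrite distrC -(hw b a)//.
  by apply: eq_integral => y _; rewrite distrC.
move=> /andP[a0 a1] /andP[b0 b1].
transitivity (\int[lebesgue]_(y in `[0%R, 1%R]) (\1_(`]a, b] : set R) y)%:E).
  apply: eq_integral => y _; rewrite indicE mem_setE in_itv/=.
  have [ya|ay] := leP y a; have [yb|b_y] := leP y b;
    rewrite /= ?subrr ?sub0r ?normrN ?normr0 ?normr1//.
  by have := lt_le_trans b_y (le_trans ya ab); rewrite ltxx.
rewrite integral_indic// (setIidl _); last first.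
  move=> y /=; rewrite !in_itv/= => /andP[ay yb].
  by rewrite (le_trans a0 (ltW ay)) (le_trans yb b1).
rewrite /= lebesgue_measure_itv/= lte_fin distrC ger0_norm ?subr_ge0//.
by move: ab; rewrite le_eqVlt => /predU1P[->|->]; rewrite ?ltxx ?subrr ?EFinB.
Qed.

Lemma integral_abs_galois (F1 F2 Q1 Q2 : R -> R) :
  measurable_fun setT F1 -> measurable_fun setT F2 ->
  (forall y, 0 <= F1 y <= 1)%R -> (forall y, 0 <= F2 y <= 1)%R ->
  (forall t, 0 <= Q1 t <= 1)%R -> (forall t, 0 <= Q2 t <= 1)%R ->
  {in `[0%R, 1%R] &, forall t y, (Q1 t <= y)%R = (t <= F1 y)%R} ->
  {in `[0%R, 1%R] &, forall t y, (Q2 t <= y)%R = (t <= F2 y)%R} ->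
  \int[lebesgue]_(y in `[0%R, 1%R]) (`|F1 y - F2 y|)%:E =
  \int[lebesgue]_(t in `[0%R, 1%R]) (`|Q1 t - Q2 t|)%:E.
Proof.
move=> mF1 mF2 F1b F2b Q1b Q2b G1 G2.
(* Indicator, at p = (y, t), of the region between the graphs of [F1] and [F2]. Integrating out t
   gives |F1 - F2|; integrating out y gives |Q1 - Q2| through the Galois equivalences. *)
pose h (p : R * R) : \bar R :=
  (`|(p.2 <= F1 p.1)%R%:R - (p.2 <= F2 p.1)%R%:R|)%:E.
have mle F : measurable_fun setT F ->
    measurable_fun setT (fun p : R * R => (p.2 <= F p.1)%R%:R : R).
  move=> mF; apply: (measurableT_comp (f := fun b : bool => b%:R : R)) => //.
  by apply: measurable_fun_ler => //; exact: measurableT_comp.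
have mh : measurable_fun setT h.
  apply/measurable_EFinP; apply: measurableT_comp => //.
  by apply: measurable_funB; exact: mle.
transitivity (\int[lebesgue]_(y in `[0%R, 1%R])
    \int[lebesgue]_(t in `[0%R, 1%R]) h (y, t)).
  by apply: eq_integral => y _; rewrite -integral_abs_stepr.
rewrite fubini_tonelli_in//; last by move=> p; rewrite lee_fin.
apply: eq_integral => t; rewrite inE/= => t01.
rewrite -integral_abs_step//; apply: eq_integral => y; rewrite inE/= => y01.
by rewrite /h/= G1 ?G2.
Qed.

End one_dimensional.

(** * The integral of the tent function *)

Section tent.
Context {R : realType}.
Local Notation lebesgue := (@lebesgue_measure R).

Lemma measurable_tent :
  measurable_fun setT (fun y : R => (Num.min (2 * y) (2 * (1 - y)))%:E).
Proof.
apply/measurable_EFinP; apply: measurable_minr => //.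
by apply: measurable_funM => //; exact: measurable_funB.
Qed.

Lemma integral_tent :
  \int[lebesgue]_(y in `[0%R, 1%R]) (Num.min (2 * y) (2 * (1 - y)))%:E =
  (1 / 2)%:E.
Proof.
have h01 : (0 < 1 / 2 :> R)%R by lra.
have h12 : (1 / 2 < 1 :> R)%R by lra.
(* The two branches of the minimum cross at 1/2, so the integrand is affine on each half. *)
rewrite (@itv_bndbnd_setU _ _ _ (BRight (1/2)%R)) ?bnd_simp; [|lra..].
rewrite ge0_integral_setU//=; last 3 first.
- exact: measurable_funTS measurable_tent.
- move=> y; rewrite /= !in_itv/= lee_fin le_min => -[]/andP[? ?];
    apply/andP; split; lra.
- apply/disj_setPS => y [/=]; rewrite !in_itv/= => /andP[_ ?] /andP[? _]; lra.
(* Adding the endpoint 1/2 changes a null set and makes both halves closed, as the fundamental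
   theorem of calculus requires. *)
rewrite integral_itv_obnd_cbnd//; last first.
  exact: measurable_funTS measurable_tent.
have continuous_lin (c d : R) : continuous (fun y : R => c * y + d)%R.
  move=> y; apply: cvgD; last exact: cvg_cst.
  by apply: cvgM; [exact: cvg_cst|exact: cvg_id].
have FTC (c d a b : R) : (a < b)%R -> 
    \int[lebesgue]_(y in `[a, b]) (c * y + d)%:E =
    ((c / 2 * b ^+ 2 + d * b) - (c / 2 * a ^+ 2 + d * a))%:E.
  move=> ab.
  have der (y : R) :
      is_derive y 1%R (fun y : R => c / 2 * y ^+ 2 + d * y)%R (c * y + d)%R.
    apply: is_derive_eq. by rewrite /GRing.scale/=; lra.
  have cont : continuous (fun y : R => c / 2 * y ^+ 2 + d * y)%R.
    move=> y; apply: differentiable_continuous; apply/derivable1_diffP.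
    exact: (@ex_derive _ _ _ _ _ _ _ (der y)).
  rewrite (@continuous_FTC2 _ _ (fun y => c / 2 * y ^+ 2 + d * y)%R)//.
  - exact: continuous_subspaceT.
  - split.
    + by move=> y _; exact: (@ex_derive _ _ _ _ _ _ _ (der y)).
    + exact/cvg_at_right_filter/cont.
    + exact/cvg_at_left_filter/cont.
  - move=> y _; rewrite derive1E. exact: (@derive_val _ _ _ _ _ _ _ (der y)).
have -> : \int[lebesgue]_(x in `[0%R, (1 / 2)%R])
    (Num.min (2 * x) (2 * (1 - x)))%:E
   = \int[lebesgue]_(x in `[0%R, (1 / 2)%R]) (2 * x + 0)%:E.
  apply: eq_integral => y; rewrite inE/= in_itv/= => /andP[? ?].
  by rewrite addr0; congr EFin; apply/min_idPl; lra.
have -> : \int[lebesgue]_(x in `[(1 / 2)%R, 1%R])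
    (Num.min (2 * x) (2 * (1 - x)))%:E
   = \int[lebesgue]_(x in `[(1 / 2)%R, 1%R]) ((- 2) * x + 2)%:E.
  apply: eq_integral => y; rewrite inE/= in_itv/= => /andP[? ?].
  have -> : (-2 * y + 2 = 2 * (1 - y))%R by lra.
  by congr EFin; apply/min_idPr; lra.
rewrite !FTC// -EFinD; congr EFin; lra.
Qed.
End tent.

(** * Conditional distribution functions of a Markov kernel *)

Section kernel_cdf.
Context d (T : measurableType d) (R : realType) (K : R.-pker T ~> R).

(** [fine] loses nothing, since the kernel values are at most 1. As [K x] is a probability on all of
    R, the value at y = 1 may be below 1 for exceptional x. *)
Definition kcdf (x : T) (y : R) : R := fine (K x `[0%R, y]%classic).

Lemma kernel_le1 x A : measurable A -> K x A <= 1.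
Proof.
by move=> mA; rewrite -(@prob_kernel _ _ _ _ _ K x) le_measure ?inE.
Qed.

Lemma kernel_fin_num x A : measurable A -> K x A \is a fin_num.
Proof.
move=> mA; rewrite ge0_fin_numE//.
exact: le_lt_trans (kernel_le1 x mA) (ltry _).
Qed.

Lemma kcdfE x y : (kcdf x y)%:E = K x `[0%R, y]%classic.
Proof. by rewrite fineK// kernel_fin_num. Qed.

Lemma kcdf_ge0_le1 x y : (0 <= kcdf x y <= 1)%R.
Proof. by rewrite -!lee_fin kcdfE measure_ge0 kernel_le1. Qed.

Lemma le_kcdf x : {homo kcdf x : y z / (y <= z)%R}.
Proof.
move=> y z yz; rewrite -lee_fin !kcdfE le_measure ?inE//.
by apply: subset_itvl; rewrite bnd_simp.
Qed.

(** Continuity from above of [K x] along the intervals from 0 to y + 1/(n+1), which decrease to the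
    interval from 0 to y. *)
Lemma kcdf_right_continuous x y a : (kcdf x y < a)%R ->
  exists2 e, (0 < e)%R & (kcdf x (y + e) < a)%R.
Proof.
move=> Fa.
have cvgF : K x `[0%R, (y + n.+1%:R^-1)%R]%classic @[n --> \oo] -->
    K x `[0%R, y]%classic.
  have -> : `[0%R, y]%classic =
      \bigcap_n (`[0%R, (y + n.+1%:R^-1)%R] : set R)%classic.
    apply/seteqP; split=> [z /= + n _|z /= zy].
      by rewrite /= !in_itv/= => /andP[-> /le_trans]; apply; rewrite lerDl.
    have z0 : (0 <= z)%R by have := zy 0%N I; rewrite /= in_itv/= => /andP[].
    rewrite in_itv/= z0/= leNgt; apply/negP => yz.
    have zy0 : (0 < z - y)%R by rewrite subr_gt0.
    have [n _ /(_ n (leqnn n))/=] := near_infty_natSinv_lt (PosNum zy0).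
    have := zy n I; rewrite /= in_itv/= z0/= -lerBlDl => zyn.
    by rewrite ltNge zyn.
  apply: nonincreasing_cvg_mu.
  - by rewrite -ge0_fin_numE// kernel_fin_num.
  - by [].
  - by apply: bigcap_measurable => //.
  - move=> m n mn; apply/subsetPset/subset_itvl; rewrite bnd_simp lerD2l.
    by rewrite lef_pV2 ?posrE// ler_nat.
have : \forall n \near \oo, K x `[0%R, (y + n.+1%:R^-1)%R]%classic < a%:E.
  apply: (cvgF [set z | z < a%:E]); rewrite -kcdfE.
  exact: (nbhs_open_ereal_lt (f := cst a)).
move=> [n _ /(_ n (leqnn n))]; rewrite /= -kcdfE lte_fin => Fn.
by exists n.+1%:R^-1%R.
Qed.

(** Joint measurability, needed for Tonelli. By monotonicity and right continuity in y, F(x, y) < a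
    holds iff F(x, q) < a for some rational q >= y, so the sublevel set is a countable union of
    measurable rectangles. *)
Lemma measurable_kcdf :
  measurable_fun [set: T * R] (fun p => kcdf p.1 p.2).
Proof.
apply: (measurability _ (RGenInftyO.measurableE R)) => //.
move=> _ [_ [a ->] <-]; rewrite setTI.
rewrite (_ : _ @^-1` _ =
  \bigcup_(q : rat)
    ([set x | kcdf x (ratr q) < a]%R `*` `]-oo, ratr q]%classic)).
  apply: bigcupT_measurable_rat => q; apply: measurableX => //.
  rewrite (_ : mkset _ =
      setT `&` [set x | K x `[0%R, ratr q]%classic < a%:E]); last first.
    by rewrite setTI; apply/seteqP; split=> x /=; rewrite -kcdfE lte_fin.
  by apply: emeasurable_fun_infty_o => //; exact: measurable_kernel.
apply/seteqP; split=> [[x y]/=|[x y] [q _] /= []].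
  rewrite in_itv/= => /kcdf_right_continuous[e e0 Fa].
  have /rat_in_itvoo[q] : (y < y + e)%R by rewrite ltrDl.
  rewrite in_itv/= => /andP[yq qe]; exists q => //; split => /=.
    by apply: le_lt_trans Fa; exact/le_kcdf/ltW.
  by rewrite in_itv/= ltW.
by rewrite !in_itv/= => Fa yq; by rewrite (le_lt_trans _ Fa)// le_kcdf.
Qed.

End kernel_cdf.

(** * Conditional quantile functions *)

Section quantile_facts.
Context {R : realType} (k : nat) (K : R.-pker (k.-tuple R) ~> R).
Implicit Types (x : k.-tuple R) (t y : R).

Let S t x := [set y : R | (0 <= y <= 1)%R /\ t%:E <= K x `[0%R, y]%classic].

Lemma quantile_ge0_le1 t x : (0 <= quantile K t x <= 1)%R.
Proof.
rewrite /quantile -/(S t x).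
(* If no y qualifies, the infimum takes its default value 0, which still lies in the unit
   interval. *)
have [->|/set0P[z zS]] := eqVneq (S t x) set0; first by rewrite inf0 lexx ler01.
have S0 : lbound (S t x) 0%R by move=> y [/andP[]].
have lbS : has_lbound (S t x) by exists 0%R.
apply/andP; split; first by apply: lb_le_inf => //; exists z.
by apply: le_trans (ge_inf lbS zS) _; case: zS => /andP[].
Qed.

(** The bound on t puts 1 into the set defining the quantile, so its infimum is genuine; right
    continuity then gives the implication from left to right. *)
Lemma quantile_le t x y : (t <= kcdf K x 1)%R -> (0 <= y <= 1)%R ->
  (quantile K t x <= y)%R = (t <= kcdf K x y)%R.
Proof.
move=> t1 /andP[y0 y1].
have S0 : has_lbound (S t x) by exists 0%R => z [/andP[]].
have S1 : S t x 1%R by split; [rewrite ler01 lexx|rewrite -kcdfE lee_fin].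
apply/idP/idP => [Qy|tF]; last first.
  by apply: ge_inf => //; split; [rewrite y0|rewrite -kcdfE lee_fin].
(* If F(y) < t, then F(y + e) < t for some e > 0; but an infimum at most y leaves a qualifying z
   below y + e, which forces t <= F(y + e). *)
rewrite leNgt; apply/negP => /kcdf_right_continuous[e e0].
apply/negP; rewrite -leNgt.
have [z [_ tz] zye] := inf_adherent e0 (conj (ex_intro _ _ S1) S0).
rewrite -lee_fin (le_trans tz)// -kcdfE lee_fin le_kcdf//.
by apply: ltW; apply: lt_le_trans zye _; rewrite lerD2r.
Qed.

Lemma quantile_eq0 t x : (kcdf K x 1 < t)%R -> quantile K t x = 0%R.
Proof.
move=> t1; rewrite /quantile (_ : mkset _ = set0) ?inf0//.
apply/seteqP; split=> // y [/andP[_ y1]]; rewrite -kcdfE lee_fin leNgt.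
by rewrite (le_lt_trans _ t1)// le_kcdf.
Qed.

(** Only levels 0 <= y < 1 are nontrivial. There Q > y means F(x, y) < t, except where F(x, 1) < t:
    on that set Q is the default 0, so it has to be removed. *)
Lemma measurable_quantile :
  measurable_fun [set: k.-tuple R * R] (fun p => quantile K p.2 p.1).
Proof.
have mF : measurable_fun [set: k.-tuple R * R]
    (fun p => (kcdf K p.1 1 < p.2)%R).
  apply: measurable_fun_ltr => //.
  apply: (measurableT_comp (f := fun x => kcdf K x 1)) => //.
  exact: (measurableT_comp (measurable_kcdf K) (pair2_measurable _)).
have mFy y : measurable_fun [set: k.-tuple R * R]
    (fun p => (kcdf K p.1 y < p.2)%R).
  apply: measurable_fun_ltr => //.
  apply: (measurableT_comp (f := fun x => kcdf K x y)) => //.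
  exact: (measurableT_comp (measurable_kcdf K) (pair2_measurable _)).
apply: (measurability _ (RGenOInfty.measurableE R)) => //.
move=> _ [_ [y ->] <-]; rewrite setTI.
have [y0|y0] := ltP y 0%R.
  rewrite (_ : _ @^-1` _ = setT)//; apply/seteqP; split=> // p _ /=.
  rewrite in_itv/= andbT (lt_le_trans y0)//.
  by have /andP[] := quantile_ge0_le1 p.2 p.1.
have [y1|y1] := leP 1%R y.
  rewrite (_ : _ @^-1` _ = set0)//; apply/seteqP; split=> // p /=.
  rewrite in_itv/= andbT ltNge (le_trans _ y1)//.
  by have /andP[] := quantile_ge0_le1 p.2 p.1.
rewrite (_ : _ @^-1` _ = [set p | (kcdf K p.1 y < p.2)%R] `\`
    [set p | (kcdf K p.1 1 < p.2)%R]).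
  by apply: measurableD; rewrite -[X in measurable X]setTI;
    [exact: mFy|exact: mF].
apply/seteqP; split=> -[x t] /=; rewrite in_itv/= andbT.
  have [t1|t1] := leP t (kcdf K x 1); last by rewrite quantile_eq0// ltNge y0.
  by rewrite ltNge quantile_le ?y0 ?(ltW y1)// -ltNge.
move=> [Ft /negP]; rewrite -leNgt => t1.
by rewrite ltNge quantile_le ?y0 ?(ltW y1)// -ltNge.
Qed.

End quantile_facts.

(** * Copula kernels: means, the upper bound and the quantile identity *)

Section copula_kernel.
Context {R : realType} (n : nat) (muA : probability (n.-tuple R) R).
Local Notation lebesgue := (@lebesgue_measure R).
Implicit Types (K : R.-pker (n.-tuple R) ~> R)
  (mu : probability (n.-tuple R * R)%type R).

(** The disintegration formula over the whole space of x, combined with the uniform last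
    marginal. *)
Lemma integral_kernel mu K (F : set R) : in_CdA muA mu ->
  is_markov_kernel_of muA mu K -> measurable F ->
  \int[muA]_x K x F = lebesgue (F `&` `[0%R, 1%R]).
Proof.
move=> [[_ umu] _] muK mF; rewrite -muK// -umu//; congr (mu _).
by apply/seteqP; split=> [[x y] []|[x y]].
Qed.

Lemma measurable_kcdf1 K y :
  measurable_fun [set: n.-tuple R] (fun x => kcdf K x y).
Proof. exact: measurableT_comp (measurable_kcdf K) (pair2_measurable _). Qed.

Lemma kcdf_compl K x y : (1 - kcdf K x y)%:E = K x (~` `[0%R, y]%classic).
Proof.
have K1 : 1 = (kcdf K x y)%:E + K x (~` `[0%R, y]%classic) :> \bar R.
  rewrite kcdfE -(@prob_kernel _ _ _ _ _ K x) -(setUv `[0%R, y]%classic).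
  by rewrite measureU//; [exact: measurableC|exact: setICr].
by rewrite EFinB K1 addeAC subee// add0e.
Qed.

Lemma integral_kcdf mu K y : in_CdA muA mu -> is_markov_kernel_of muA mu K ->
  (0 <= y <= 1)%R -> \int[muA]_x (kcdf K x y)%:E = y%:E.
Proof.
move=> muC muK /andP[y0 y1].
transitivity (\int[muA]_x K x `[0%R, y]%classic).
  by apply: eq_integral => x _; rewrite kcdfE.
rewrite (integral_kernel muC muK)// (setIidl _); last first.
  by apply: subset_itvl; rewrite bnd_simp.
rewrite lebesgue_measure_itv/= lte_fin sube0.
by move: y0; rewrite le_eqVlt => /predU1P[<-|->]; rewrite ?ltxx.
Qed.

Lemma integral_kcdf_compl mu K y : in_CdA muA mu ->
  is_markov_kernel_of muA mu K -> (0 <= y <= 1)%R ->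
  \int[muA]_x (1 - kcdf K x y)%:E = (1 - y)%:E.
Proof.
move=> muC muK /andP[y0 y1].
transitivity (\int[muA]_x K x (~` `[0%R, y]%classic)).
  by apply: eq_integral => x _; rewrite kcdf_compl.
rewrite (integral_kernel muC muK)//; last exact: measurableC.
rewrite (_ : _ `&` _ = `]y, 1%R]%classic); last first.
  apply/seteqP; split=> z /=; rewrite !in_itv/=.
    by move=> [/negP + /andP[z0 ->]]; rewrite z0/= -ltNge => ->.
  by move=> /andP[yz ->]; rewrite (leNgt z y) yz andbF (le_trans y0 (ltW yz)).
rewrite lebesgue_measure_itv/= lte_fin.
by move: y1; rewrite le_eqVlt => /predU1P[->|->]; rewrite ?ltxx ?subrr ?EFinB.
Qed.

Lemma measurable_kcdf_lt K y a : measurable [set x | (kcdf K x y < a)%R].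
Proof.
rewrite -[X in measurable X]setTI.
exact: (measurable_fun_ltr (measurable_kcdf1 K y) (measurable_cst a)).
Qed.

(** The nonnegative function 1 - F(x, 1) has mean 1 - 1 = 0, so it vanishes almost everywhere. *)
Lemma kcdf_at1_null mu K : in_CdA muA mu -> is_markov_kernel_of muA mu K ->
  muA [set x | (kcdf K x 1 < 1)%R] = 0.
Proof.
move=> muC muK.
have : \int[muA]_x `|(1 - kcdf K x 1)%:E| = 0.
  transitivity (\int[muA]_x (1 - kcdf K x 1)%:E).
    apply: eq_integral => x _; rewrite gee0_abs// lee_fin subr_ge0.
    by have /andP[] := kcdf_ge0_le1 K x 1.
  by rewrite (integral_kcdf_compl muC muK) ?subrr// ler01 lexx.
move/ae_eq_integral_abs => /(_ measurableT) []//.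
  apply/measurable_EFinP; apply: measurable_funB => //.
  exact: measurable_kcdf1.
move=> N [mN N0 subN].
apply: measure_negligible; first exact: measurable_kcdf_lt.
exists N; split=> //; apply: subset_trans subN => x /= x1 /(_ I)[] /eqP.
by rewrite subr_eq0 eq_sym => /eqP x1'; rewrite x1' ltxx in x1.
Qed.

Lemma D_A1E K1 K2 : D_A1 muA K1 K2 =
  \int[lebesgue]_(y in `[0%R, 1%R])
     \int[muA]_x (`|kcdf K1 x y - kcdf K2 x y|)%:E.
Proof.
by apply: eq_integral => y _; apply: eq_integral => x _; rewrite -!kcdfE.
Qed.

Lemma integral_kcdf_dist_le mu1 mu2 K1 K2 y :
  in_CdA muA mu1 -> in_CdA muA mu2 ->
  is_markov_kernel_of muA mu1 K1 -> is_markov_kernel_of muA mu2 K2 ->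
  (0 <= y <= 1)%R ->
  \int[muA]_x (`|kcdf K1 x y - kcdf K2 x y|)%:E <=
  (Num.min (2 * y) (2 * (1 - y)))%:E.
Proof.
move=> mu1C mu2C muK1 muK2 y01.
have mF K : measurable_fun setT (fun x => kcdf K x y).
  exact: measurable_kcdf1.
have F0 K x : (0 <= kcdf K x y)%R by have /andP[] := kcdf_ge0_le1 K x y.
have F1 K x : (kcdf K x y <= 1)%R by have /andP[] := kcdf_ge0_le1 K x y.
have mdist : measurable_fun setT
    (fun x => (`|kcdf K1 x y - kcdf K2 x y|)%:E).
  apply/measurable_EFinP; apply: measurableT_comp => //.
  exact: measurable_funB.
rewrite EFin_min le_min; apply/andP; split.
- have -> : (2 * y)%:E = \int[muA]_x ((kcdf K1 x y)%:E + (kcdf K2 x y)%:E).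
    rewrite ge0_integralD//;
      [|by move=> x _; rewrite lee_fin|exact/measurable_EFinP
       |by move=> x _; rewrite lee_fin|exact/measurable_EFinP].
    rewrite (integral_kcdf mu1C muK1)// (integral_kcdf mu2C muK2)// -EFinD.
    by congr EFin; lra.
  apply: ge0_le_integral => //.
  + by apply: emeasurable_funD; exact/measurable_EFinP.
  + move=> x _; rewrite -EFinD lee_fin ler_norml.
    have := F0 K1 x; have := F0 K2 x; lra.
- have -> : (2 * (1 - y))%:E =
     \int[muA]_x ((1 - kcdf K1 x y)%:E + (1 - kcdf K2 x y)%:E).
    rewrite ge0_integralD//;
      [|by move=> x _; rewrite lee_fin subr_ge0
       |by apply/measurable_EFinP; exact: measurable_funB
       |by move=> x _; rewrite lee_fin subr_ge0
       |by apply/measurable_EFinP; exact: measurable_funB].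
    rewrite (integral_kcdf_compl mu1C muK1)//.
    rewrite (integral_kcdf_compl mu2C muK2)// -EFinD.
    by congr EFin; lra.
  apply: ge0_le_integral => //.
  + by apply: emeasurable_funD; apply/measurable_EFinP; exact: measurable_funB.
  + move=> x _; rewrite -EFinD lee_fin ler_norml.
    have := F1 K1 x; have := F1 K2 x; lra.
Qed.

Lemma measurable_kcdf_dist K1 K2 : measurable_fun [set: R * n.-tuple R]
  (fun p => (`|kcdf K1 p.2 p.1 - kcdf K2 p.2 p.1|)%:E).
Proof.
apply/measurable_EFinP; apply: measurableT_comp => //.
by apply: measurable_funB;
  exact: (measurableT_comp (measurable_kcdf _) (@measurable_swap _ _ _ _)).
Qed.

Lemma measurable_integral_kcdf_dist K1 K2 :
  measurable_fun [set: measurableTypeR R]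
  (fun y => \int[muA]_x (`|kcdf K1 x y - kcdf K2 x y|)%:E).
Proof.
apply: (measurable_fun_fubini_tonelli_F (m2 := muA)
  (fun p : R * n.-tuple R => (`|kcdf K1 p.2 p.1 - kcdf K2 p.2 p.1|)%:E)) => //.
exact: measurable_kcdf_dist.
Qed.

Lemma measurable_quantile_dist K1 K2 : measurable_fun [set: R * n.-tuple R]
  (fun p => (`|quantile K1 p.1 p.2 - quantile K2 p.1 p.2|)%:E).
Proof.
apply/measurable_EFinP; apply: measurableT_comp => //.
by apply: measurable_funB;
  exact: (measurableT_comp (measurable_quantile _) (@measurable_swap _ _ _ _)).
Qed.

Lemma D_A1_le mu1 mu2 K1 K2 :
  in_CdA muA mu1 -> in_CdA muA mu2 ->
  is_markov_kernel_of muA mu1 K1 -> is_markov_kernel_of muA mu2 K2 ->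
  D_A1 muA K1 K2 <= (1 / 2)%:E.
Proof.
move=> mu1C mu2C muK1 muK2; rewrite D_A1E -integral_tent.
apply: ge0_le_integral => //.
- move=> y _; exact: integral_ge0.
- by apply: measurable_funTS; exact: measurable_integral_kcdf_dist.
- exact: measurable_funTS measurable_tent.
- move=> y; rewrite /= in_itv/=.
  exact: (integral_kcdf_dist_le mu1C mu2C muK1 muK2).
Qed.

Lemma D_A1_quantile mu1 mu2 K1 K2 :
  in_CdA muA mu1 -> in_CdA muA mu2 ->
  is_markov_kernel_of muA mu1 K1 -> is_markov_kernel_of muA mu2 K2 ->
  D_A1 muA K1 K2 = quantile_dist muA K1 K2.
Proof.
move=> mu1C mu2C muK1 muK2; rewrite D_A1E /quantile_dist.
(* Off this null set both distribution functions reach 1, so [quantile_le] applies to every t in the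
   unit interval. *)
pose N := [set x | (kcdf K1 x 1 < 1)%R] `|` [set x | (kcdf K2 x 1 < 1)%R].
have mN : measurable N by apply: measurableU; exact: measurable_kcdf_lt.
have N0 : muA N = 0.
  by rewrite measureU0//; [exact: kcdf_at1_null mu1C muK1
    |exact: measurable_kcdf_lt|exact: measurable_kcdf_lt
    |exact: kcdf_at1_null mu2C muK2].
pose f (p : R * n.-tuple R) := (`|kcdf K1 p.2 p.1 - kcdf K2 p.2 p.1|)%:E.
pose g (p : R * n.-tuple R) :=
  (`|quantile K1 p.1 p.2 - quantile K2 p.1 p.2|)%:E.
have mf : measurable_fun [set: R * n.-tuple R] f by exact: measurable_kcdf_dist.
have mg : measurable_fun [set: R * n.-tuple R] g.
  exact: measurable_quantile_dist.
transitivity (\int[lebesgue]_(y in `[0%R, 1%R]) \int[muA]_(x in ~` N) f (y, x)).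
  apply: eq_integral => y _; rewrite -setTD.
  apply: ge0_negligible_integral => //.
  exact: (measurableT_comp mf (pair1_measurable _)).
transitivity (\int[lebesgue]_(y in `[0%R, 1%R])
    \int[muA]_(x in ~` N) g (y, x)); last first.
  apply: eq_integral => y _; rewrite -setTD; apply/esym.
  apply: ge0_negligible_integral => //.
  exact: (measurableT_comp mg (pair1_measurable _)).
have mCN : measurable (~` N) by exact: measurableC.
have f0 p : 0 <= f p by rewrite lee_fin.
have g0 p : 0 <= g p by rewrite lee_fin.
(* With x outermost on both sides, the identity reduces to a fixed x outside [N]. *)
rewrite !fubini_tonelli_in//.
apply: eq_integral => x; rewrite inE/= => Nx.
have /andP[K11 K21] : (1 <= kcdf K1 x 1)%R && (1 <= kcdf K2 x 1)%R.
  rewrite !leNgt; apply/andP.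
  by split; apply/negP => lt1; apply: Nx; [left|right].
have Fx K : measurable_fun setT (kcdf K x).
  exact: (measurableT_comp (measurable_kcdf K) (pair1_measurable _)).
apply: integral_abs_galois => //.
- exact: kcdf_ge0_le1.
- exact: kcdf_ge0_le1.
- by move=> t; exact: quantile_ge0_le1.
- by move=> t; exact: quantile_ge0_le1.
- move=> t y; rewrite !in_itv/= => /andP[_ t1] y01.
  by apply: quantile_le => //; exact: le_trans K11.
- move=> t y; rewrite !in_itv/= => /andP[_ t1] y01.
  by apply: quantile_le => //; exact: le_trans K21.
Qed.

End copula_kernel.

(** * Completely dependent copulas attaining the bound *)

Section extremal.
Context {R : realType} (n : nat) (muA : probability (n.-tuple R) R).
Local Notation lebesgue := (@lebesgue_measure R).

(** The image of Lebesgue measure under the reflection agrees with it on the half-open intervals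
    []a, b]], which determine it. *)
Lemma lebesgue_onem (B : set R) : measurable B ->
  lebesgue ((fun u => 1 - u)%R @^-1` B) = lebesgue B.
Proof.
move=> mB.
have m1B : measurable_fun [set: measurableTypeR R]
    (fun u : measurableTypeR R => 1 - u : measurableTypeR R)%R.
  exact: measurable_funB.
pose nu := pushforward lebesgue
  (fun u : measurableTypeR R => 1 - u : measurableTypeR R)%R.
rewrite [RHS](@lebesgue_measure_unique R nu)//.
move=> _ [[a b] _ <-]/=; rewrite /nu /pushforward/=.
rewrite (_ : _ @^-1` _ = `[(1 - b)%R, (1 - a)%R[%classic); last first.
  by apply/seteqP; split=> u /=; rewrite !in_itv/= => /andP[? ?];
    apply/andP; split; lra.
rewrite !lebesgue_measure_itv/= !lte_fin ltrD2l ltrN2.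
by case: ifPn => // _; rewrite -!EFinB; congr EFin; lra.
Qed.

Lemma uniform_marginal_onem (f : n.-tuple R -> R) :
  uniform_marginal muA f -> uniform_marginal muA (fun x => 1 - f x)%R.
Proof.
move=> fU B mB.
have m1B : measurable ((fun u : R => 1 - u)%R @^-1` B).
  rewrite -[X in measurable X]setTI.
  suff : measurable_fun [set: R] (fun u : R => 1 - u)%R by exact.
  exact: measurable_funB.
rewrite -(lebesgue_onem (measurableI _ _ mB (measurable_itv `[0%R, 1%R]))).
rewrite (fU _ m1B) preimage_setI; congr (lebesgue (_ `&` _)).
by apply/seteqP; split=> u /=; rewrite !in_itv/= => /andP[? ?];
  apply/andP; split; lra.
Qed.

Section graph.
Variables (f : n.-tuple R -> R) (mf : measurable_fun setT f).

Let graph x := (x, f x).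

Let mgraph : measurable_fun setT graph.
Proof. exact: measurable_fun_pair. Qed.

HB.instance Definition _ := isMeasurableFun.Build _ _ _ _ graph mgraph.

(** The law of (X, f(X)) for X of law [muA]: the completely dependent copula when [f] is uniform. *)
Definition graph_distribution : probability (n.-tuple R * R)%type R :=
  distribution muA graph.

Lemma graph_in_CdA : is_copula_measure muA -> uniform_marginal muA f ->
  in_CdA muA graph_distribution.
Proof.
move=> muAC fU; split; first by split=> [i|] B mB; [exact: muAC|exact: fU].
move=> B mB; rewrite /graph_distribution/= /distribution /pushforward/=.
by congr (muA _); apply/seteqP; split=> [x []|x].
Qed.

(** The Dirac mass at f(x) evaluated on F is the indicator of the preimage of F under [f]. *)
Lemma graph_markov_kernel :
  is_markov_kernel_of muA graph_distribution (kdirac mf).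
Proof.
move=> B F mB mF.
have mfF : measurable (f @^-1` F).
  by rewrite -[X in measurable X]setTI; exact: mf.
transitivity (muA (f @^-1` F `&` B)).
  by congr (muA _); apply/seteqP; split=> x [].
by rewrite -integral_indic//.
Qed.

End graph.

Lemma kcdf_kdirac (f : n.-tuple R -> R) (mf : measurable_fun setT f) x y :
  kcdf (kdirac mf) x y = (0 <= f x <= y)%R%:R.
Proof. by rewrite /kcdf [kdirac mf x _]diracE mem_setE. Qed.

(** Both triangle inequalities behind the upper bound become equalities in the mean: f <= y and 1 -
    f <= y exclude each other for y < 1/2, as do f > y and 1 - f > y for y >= 1/2. *)
Lemma D_A1_antithetic (f : n.-tuple R -> R) (mf : measurable_fun setT f)
    (mg : measurable_fun setT (fun x => 1 - f x)%R) :
  is_copula_measure muA -> uniform_marginal muA f ->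
  uniform_marginal muA (fun x => 1 - f x)%R ->
  (1 / 2)%:E <= D_A1 muA (kdirac mf) (kdirac mg).
Proof.
move=> muAC fU gU; rewrite D_A1E -integral_tent.
have muC1 := graph_in_CdA mf muAC fU.
have muK1 := graph_markov_kernel mf.
have muC2 := graph_in_CdA mg muAC gU.
have muK2 := graph_markov_kernel mg.
apply: ge0_le_integral => //.
- move=> y; rewrite /= in_itv/= lee_fin le_min => /andP[? ?].
  by apply/andP; split; lra.
- exact: measurable_funTS measurable_tent.
- by apply: measurable_funTS; exact: measurable_integral_kcdf_dist.
move=> y; rewrite /= in_itv/= => /andP[y0 y1].
have mdist : measurable_fun setT
    (fun x => (`|kcdf (kdirac mf) x y - kcdf (kdirac mg) x y|)%:E).
  exact: (measurableT_comp (measurable_kcdf_dist _ _) (pair1_measurable _)).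
have y01 : (0 <= y <= 1)%R by rewrite y0 y1.
have [y2|y2] := ltP y (1 / 2)%R.
  have -> : (Num.min (2 * y) (2 * (1 - y)))%:E =
      \int[muA]_x (kcdf (kdirac mf) x y)%:E +
      \int[muA]_x (kcdf (kdirac mg) x y)%:E.
    rewrite (integral_kcdf muC1 muK1 y01) (integral_kcdf muC2 muK2 y01) -EFinD.
    by congr EFin; rewrite (min_idPl _); lra.
  rewrite -ge0_integralD//.
  - apply: ge0_le_integral => //.
    + by move=> x _; rewrite !kcdf_kdirac adde_ge0// lee_fin.
    + by apply: emeasurable_funD; apply/measurable_EFinP;
        exact: measurable_kcdf1.
    + move=> x _; rewrite -EFinD lee_fin !kcdf_kdirac.
      case: andP => [[f0 fy]|_]; case: andP => [[g0 gy]|_];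
        rewrite ?addr0 ?add0r ?subr0 ?sub0r ?normrN ?normr1 ?normr0//.
      lra.
  - by move=> x _; rewrite kcdf_kdirac lee_fin.
  - by apply/measurable_EFinP; exact: measurable_kcdf1.
  - by move=> x _; rewrite kcdf_kdirac lee_fin.
  - by apply/measurable_EFinP; exact: measurable_kcdf1.
have Ic : (`]y, 1%R] `&` `[0%R, 1%R] = `]y, 1%R] :> set R)%classic.
  apply: setIidl => z /=; rewrite !in_itv/= => /andP[yz ->].
  by rewrite (le_trans y0 (ltW yz)).
have lI : lebesgue `]y, 1%R]%classic = (1 - y)%:E.
  rewrite lebesgue_measure_itv/= lte_fin.
  by move: (y1); rewrite le_eqVlt => /predU1P[->|->];
    rewrite ?ltxx ?subrr ?EFinB.
(* The mass above y is cut off at 1 because [f] lies in the unit interval only almost surely. Where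
   f(x) is outside it, so is 1 - f(x); the complement of the interval from 0 to y would count both
   points although |F1 - F2| = 0. *)
have -> : (Num.min (2 * y) (2 * (1 - y)))%:E =
    \int[muA]_x (kdirac mf x `]y, 1%R]%classic) +
    \int[muA]_x (kdirac mg x `]y, 1%R]%classic).
  rewrite (integral_kernel muC1 muK1)// (integral_kernel muC2 muK2)//.
  rewrite Ic lI -EFinD.
  by congr EFin; rewrite (min_idPr _); lra.
rewrite -ge0_integralD//; [|exact: measurable_kernel|exact: measurable_kernel].
apply: ge0_le_integral => //.
- by move=> x _; rewrite adde_ge0.
- by apply: emeasurable_funD; exact: measurable_kernel.
- move=> x _; rewrite !kcdf_kdirac [kdirac mf x _]diracE [kdirac mg x _]diracE.
  rewrite !mem_setE !in_itv/=.
  rewrite -EFinD lee_fin.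
  have [/andP[yf f1]|_] := boolP (y < f x <= 1)%R.
    have -> : (y < 1 - f x)%R = false by apply/negbTE; rewrite -leNgt; lra.
    have -> : (f x <= y)%R = false by apply/negbTE; rewrite -ltNge.
    have -> : (0 <= 1 - f x <= y)%R by apply/andP; split; lra.
    by rewrite andbF sub0r normrN normr1 addr0.
  have [/andP[yg g1]|_] := boolP (y < 1 - f x <= 1)%R; last first.
    by rewrite addr0 normr_ge0.
  have -> : (1 - f x <= y)%R = false by apply/negbTE; rewrite -ltNge.
  have -> : (0 <= f x <= y)%R by apply/andP; split; lra.
  by rewrite andbF subr0 normr1 add0r.
Qed.

End extremal.

(* d = n + 1 with d >= 2, i.e. n >= 1; A in C^{n}, C1, C2 in C^{n+1}_A. *)
Theorem theorem21 (R : realType) (n : nat) (hn : (1 <= n)%N)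
    (muA : probability (n.-tuple R) R) (hA : is_copula_measure muA) :
  (forall (mu1 mu2 : probability (n.-tuple R * R)%type R)
          (K1 K2 : R.-pker (n.-tuple R) ~> R),
      in_CdA muA mu1 -> in_CdA muA mu2 ->
      is_markov_kernel_of muA mu1 K1 -> is_markov_kernel_of muA mu2 K2 ->
      D_A1 muA K1 K2 = quantile_dist muA K1 K2 /\
      D_A1 muA K1 K2 <= (1 / 2)%:E) /\
  (exists (mu1 mu2 : probability (n.-tuple R * R)%type R)
          (K1 K2 : R.-pker (n.-tuple R) ~> R),
      [/\ in_CdA muA mu1, in_CdA muA mu2,
          is_markov_kernel_of muA mu1 K1, is_markov_kernel_of muA mu2 K2 &
          D_A1 muA K1 K2 = (1 / 2)%:E]).
Proof.
split=> [mu1 mu2 K1 K2 mu1C mu2C muK1 muK2|].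
  by split; [exact: D_A1_quantile mu1C mu2C muK1 muK2
            |exact: D_A1_le mu1C mu2C muK1 muK2].
(* [hn] provides a first coordinate and [hA] makes it uniform. *)
pose f (x : n.-tuple R) : R := tnth x (Ordinal hn).
have mf : measurable_fun setT f := measurable_tnth (Ordinal hn).
have mg : measurable_fun setT (fun x => 1 - f x)%R :=
  measurable_funB (measurable_cst _) mf.
have fU : uniform_marginal muA f by exact: hA.
have gU := uniform_marginal_onem fU.
have mu1C := graph_in_CdA mf hA fU.
have muK1 := graph_markov_kernel muA mf.
have mu2C := graph_in_CdA mg hA gU.
have muK2 := graph_markov_kernel muA mg.
exists (graph_distribution muA mf), (graph_distribution muA mg).
exists (kdirac mf), (kdirac mg); split=> //.
apply/eqP; rewrite eq_le (D_A1_le mu1C mu2C muK1 muK2)/=.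
exact: D_A1_antithetic.
Qed.
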